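(* Let $n\in\mathbb N$ and let $A,B,F,G$ be real $n\times n$ matrices. If $F+G$ and $F-G$ are invertible, then for every $c\in\mathbb R^n$ the equation $$Fu'(t)+Gu'(-t)+Au(t)+Bu(-t)=0,\quad t\in\mathbb R,$$ for $u:\mathbb R\to\mathbb R^n$, coupled with the condition $u(0)=c$, has at most one solution.
   Context: $u'(-t)$ denotes the derivative $u'$ evaluated at $-t$; solutions are differentiable functions $u:\mathbb R\to\mathbb R^n$. *)

(* Defs.v *)
From HB Require Import structures.
From mathcomp Require Import all_boot all_order all_algebra.
From mathcomp Require Import all_classical all_reals all_analysis.

Set Implicit Arguments.
Unset Strict Implicit.
Unset Printing Implicit Defensive.

Import Order.TTheory GRing.Theory Num.Theory.
Import numFieldNormedType.Exports.

Local Open Scope classical_set_scope.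
Local Open Scope ring_scope.

(* [derive1] is total, so differentiability of u is required separately.
   (derive1 u (- t)) is u' evaluated at -t, not the derivative of t |-> u (- t). *)
Definition reflection_solution (R : realType) (n : nat) (F G A B : 'M[R]_n)
    (u : R -> 'cV[R]_n) : Prop :=
  (forall t : R, derivable u t 1) /\
  (forall t : R,
     F *m derive1 u t + G *m derive1 u (- t) + A *m u t + B *m u (- t) = 0).

(* Main.v *)
(* The difference w of two solutions solves the same equation with w(0) = 0.
   For e(t) = w(t) + w(-t) and o(t) = w(t) - w(-t), adding and subtracting the
   equations at t and -t gives (F + G) o' + (A + B) e = 0 and
   (F - G) e' + (A - B) o = 0, so that (e, o) solves an ordinary linear system
   z' = M z with z(0) = 0. For such z, the energy E = |z|^2 satisfies
   E' <= K E with K = 2 sum |M_ij|, and E = 0 by Gronwall's argument. *)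

Require Import Defs.
From HB Require Import structures.
From mathcomp Require Import all_boot all_order all_algebra.
From mathcomp Require Import all_classical all_reals all_analysis.
From mathcomp Require Import ring lra.

Set Implicit Arguments.
Unset Strict Implicit.
Unset Printing Implicit Defensive.

Import Order.TTheory GRing.Theory Num.Theory.
Import numFieldNormedType.Exports.

Local Open Scope ring_scope.

Lemma is_derive_mxP (R : realFieldType) (V : normedModType R) (m n : nat)
    (M : V -> 'M[R]_(m, n)) (t v : V) (dM : 'M[R]_(m, n)) :
  is_derive t v M dM <->
  forall i j, is_derive t v (fun x => M x i j) (dM i j).
Proof.
split=> [[dMt <-] i j|dMt].
  split; last by rewrite derive_mx// mxE.
  by move/derivable_mxP: dMt; exact.
have derM : derivable M t v by apply/derivable_mxP => i j; case: (dMt i j).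
split=> //; rewrite derive_mx//; apply/matrixP => i j.
by rewrite mxE; case: (dMt i j).
Qed.

(** Chain rule with inner map [-%R]. It serves twice: to reverse time in a linear system, and to
    differentiate the reflected term [w (- s)]. *)
Lemma is_derive_comp_opp (R : realFieldType) (V : normedModType R)
    (f : R -> V) (t : R) (df : V) :
  is_derive (- t) 1 f df -> is_derive t 1 (fun s => f (- s)) (- df).
Proof.
move=> [fdiff <-].
have /derivable1_diffP f_diff := fdiff.
have N_diff : differentiable (-%R : R -> R) t by exact/derivable1_diffP.
split; first exact/derivable1_diffP/(differentiable_comp N_diff).
rewrite deriveE; last exact: (differentiable_comp N_diff).
rewrite diff_comp//= diff_val deriveE//= /GRing.opp_fun/=.
by rewrite linearN.
Qed.

(** Integrating factor: [E s * expR (- K * s)] has a nonpositive derivative, so for [t >= 0] its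
    value at [t] is at most [E 0]; the exponential is positive. *)
Lemma gronwall_le0 (R : realType) (E dE : R -> R) (K : R) :
  (forall t : R, is_derive t 1 E (dE t)) -> (forall t, dE t <= K * E t) ->
  E 0 <= 0 -> forall t, 0 <= t -> E t <= 0.
Proof.
move=> derE dE_le E0 t t0.
pose h (s : R) := E s * expR (- K * s).
have derh (s : R) : is_derive s 1 h ((dE s - K * E s) * expR (- K * s)).
  have derexp : is_derive s 1 (fun s : R => expR (- K * s)) (- K * expR (- K * s)).
    have derlin : is_derive s 1 ( *%R (- K)) (- K).
      by apply: is_derive_eq; rewrite /GRing.scale/= mulr1.
    have := is_derive1_comp (is_derive_expR (- K * s)) derlin.
    by rewrite mulrC.
  apply: is_derive_eq; rewrite /GRing.scale/=; ring.
have h_le : h t <= h 0.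
  apply: (@ler0_derive1_nincry R h 0) => //.
  - move=> s _; rewrite derive1E derive_val.
    by rewrite mulr_le0_ge0 ?expR_ge0// subr_le0.
  - apply: derivable_within_continuous => s _.
    by case: (derh s).
move: h_le; rewrite /h mulr0 expR0 mulr1 => /le_trans/(_ E0).
by rewrite pmulr_lle0// expR_gt0.
Qed.

Lemma linear_ode_zero_ge0 (R : realType) (m : nat) (M : 'M[R]_m)
    (z : R -> 'cV[R]_m) :
  (forall t : R, is_derive t 1 z (M *m z t)) -> z 0 = 0 ->
  forall t, 0 <= t -> z t = 0.
Proof.
move=> derz z0 t t0.
pose E (s : R) := \sum_i z s i 0 ^+ 2.
pose dE (s : R) := \sum_i 2 * (z s i 0 * \sum_j M i j * z s j 0).
have derE (s : R) : is_derive s 1 E (dE s).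
  have derzi i : is_derive s 1 (fun x => z x i 0 ^+ 2)
      (2 * (z s i 0 * \sum_j M i j * z s j 0)).
    have /is_derive_mxP/(_ i 0) derzi := derz s.
    apply: is_derive_eq.
    by rewrite /GRing.scale/= mxE; ring.
  have := is_derive_sum derzi.
  by congr (is_derive _ _ _ _); apply/funext => x; rewrite fct_sumE.
have sq_le s i : z s i 0 ^+ 2 <= E s.
  by rewrite /E (bigD1 i)//= lerDl sumr_ge0// => j _; exact: sqr_ge0.
have dE_le s : dE s <= (\sum_i \sum_j 2 * `|M i j|) * E s.
  rewrite /dE mulr_suml; apply: ler_sum => i _.
  rewrite mulr_suml mulr_sumr mulr_sumr; apply: ler_sum => j _.
  rewrite -mulrA ler_pM2l// mulrCA.
  apply: (le_trans (ler_norm _)); rewrite normrM ler_wpM2l//.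
  (* With [a], [b] the absolute values of the two entries, [a ^+ 2 <= E s] and [b ^+ 2 <= E s] give
     [a * b <= E s], because [2 * a * b <= a ^+ 2 + b ^+ 2]. *)
  have := sq_le s i; have := sq_le s j.
  rewrite normrM -(real_normK (num_real (z s i 0))).
  rewrite -(real_normK (num_real (z s j 0))); nra.
have E0 : E 0 <= 0.
  by rewrite /E big1// => i _; rewrite z0 mxE expr0n.
have Et := gronwall_le0 derE dE_le E0 t0.
apply/matrixP => i j; rewrite ord1 mxE; apply/eqP.
by rewrite -sqrf_eq0 eq_le sqr_ge0 (le_trans (sq_le t i)).
Qed.

(** Negative times reduce to positive ones by time reversal: [z (- s)] solves the system with matrix
    [- M]. *)
Lemma linear_ode_zero (R : realType) (m : nat) (M : 'M[R]_m)
    (z : R -> 'cV[R]_m) :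
  (forall t : R, is_derive t 1 z (M *m z t)) -> z 0 = 0 ->
  forall t, z t = 0.
Proof.
move=> derz z0 t; have [t0|/ltW t0] := leP 0 t.
  exact: linear_ode_zero_ge0 derz z0 t t0.
rewrite -(opprK t).
apply: (@linear_ode_zero_ge0 R m (- M) (fun s => z (- s))).
- by move=> s; rewrite mulNmx; exact: is_derive_comp_opp.
- by rewrite oppr0.
- by rewrite oppr_ge0.
Qed.

Lemma is_derive_col_mx (R : realFieldType) (V : normedModType R)
    (m1 m2 n : nat) (f : V -> 'M[R]_(m1, n)) (g : V -> 'M[R]_(m2, n))
    (t v : V) (df : 'M[R]_(m1, n)) (dg : 'M[R]_(m2, n)) :
  is_derive t v f df -> is_derive t v g dg ->
  is_derive t v (fun x => col_mx (f x) (g x)) (col_mx df dg).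
Proof.
move=> /is_derive_mxP derf /is_derive_mxP derg; apply/is_derive_mxP => i j.
rewrite mxE; under eq_fun do rewrite mxE.
by case: (fintype.split i).
Qed.

Lemma reflection_solutionB (R : realType) (n : nat) (F G A B : 'M[R]_n)
    (u v : R -> 'cV[R]_n) :
  reflection_solution F G A B u -> reflection_solution F G A B v ->
  reflection_solution F G A B (u - v).
Proof.
move=> [du equ] [dv eqv]; split=> t; first exact: derivableB.
rewrite !derive1E !deriveB// -!derive1E !mulmxBr.
(* The right side becomes [0 - 0], and each zero is expanded into one of the two equations; what
   remains is to sort the [u] terms from the [v] terms. *)
rewrite -[RHS](subrr 0) -[in X in _ = X - _](equ t) -(eqv t) !opprD.
by rewrite (AC (2*2*2*2) ((1*3*5*7)*(2*4*6*8))).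
Qed.

Lemma reflection_solution_zero (R : realType) (n : nat) (A B F G : 'M[R]_n)
    (w : R -> 'cV[R]_n) :
  F + G \in unitmx -> F - G \in unitmx ->
  reflection_solution F G A B w -> w 0 = 0 -> forall t, w t = 0.
Proof.
move=> FGD FGB [dw eqw] w0 t.
pose e (s : R) := w s + w (- s); pose o (s : R) := w s - w (- s).
pose P := - (invmx (F - G) *m (A - B)); pose Q := - (invmx (F + G) *m (A + B)).
have derw (s : R) : is_derive s 1 w (derive1 w s).
  by rewrite derive1E; exact: derivableP.
have derwN s := is_derive_comp_opp (derw (- s)).
have dere (s : R) : is_derive s 1 e (P *m o s).
  apply: is_derive_eq; rewrite /P mulNmx -mulmxA -mulmxN.
  (* Moving [invmx (F - G)] across leaves [F - G] applied to the derivative of [e], which is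
     [w'(s) - w'(-s)]: the equation at [s] minus the one at [- s]. *)
  apply: (canRL (mulKmx FGB)).
  have := eqw (- s); have := eqw s; rewrite /o opprK.
  rewrite !mulmxBl !mulmxBr.
  (* Once the eight products are opaque matrices, the claim is linear arithmetic on each entry. *)
  move: (F *m _) (F *m _) (G *m _) (G *m _) (A *m _) (A *m _) (B *m _) (B *m _).
  move=> f1 f2 g1 g2 a1 a2 b1 b2 /matrixP eq1 /matrixP eq2.
  by apply/matrixP => i j; move: (eq1 i j) (eq2 i j); rewrite !mxE; lra.
have dero (s : R) : is_derive s 1 o (Q *m e s).
  apply: is_derive_eq; rewrite /Q mulNmx -mulmxA -mulmxN opprK.
  apply: (canRL (mulKmx FGD)).
  have := eqw (- s); have := eqw s; rewrite /e opprK.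
  rewrite !mulmxDl !mulmxDr.
  move: (F *m _) (F *m _) (G *m _) (G *m _) (A *m _) (A *m _) (B *m _) (B *m _).
  move=> f1 f2 g1 g2 a1 a2 b1 b2 /matrixP eq1 /matrixP eq2.
  by apply/matrixP => i j; move: (eq1 i j) (eq2 i j); rewrite !mxE; lra.
have z0 s : col_mx (e s) (o s) = 0.
  (* The diagonal blocks are zero since differentiation exchanges even and odd parts. *)
  apply: (@linear_ode_zero R _ (block_mx 0 P Q 0)
    (fun s => col_mx (e s) (o s))) => [r|].
    rewrite mul_block_col !mul0mx add0r addr0; exact: is_derive_col_mx.
  by rewrite /e /o oppr0 w0 addr0 subrr col_mx0.
move: (z0 t); rewrite -[RHS]col_mx0 => /eq_col_mx[et ot].
(* [w t] is half of [e t + o t]. *)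
apply/matrixP => i j; move/matrixP/(_ i j): et; move/matrixP/(_ i j): ot.
by rewrite !mxE; lra.
Qed.

Theorem lemma4p2 (R : realType) (n : nat) (A B F G : 'M[R]_n)
    (FG_add_unit : F + G \in unitmx) (FG_sub_unit : F - G \in unitmx)
    (c : 'cV[R]_n) (u v : R -> 'cV[R]_n) :
  reflection_solution F G A B u -> u 0 = c ->
  reflection_solution F G A B v -> v 0 = c ->
  u = v.
Proof.
move=> solu u0 solv v0; apply/funext => t; apply/subr0_eq.
apply: (reflection_solution_zero FG_add_unit FG_sub_unit
  (reflection_solutionB solu solv)).
by rewrite -[LHS]/(u 0 - v 0) u0 v0 subrr.
Qed.
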